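(* For each $n\ge 4$ there exist $N\in\mathbb N$ and a sequence $A_1,\dots,A_N$ of $n\times n$ matrices given by Rauzy induction (that is, the matrices of a Rauzy path on irreducible permutations of $\{1,\dots,n\}$) that is $C$-complete with $C=\lfloor\log_2(n)-1\rfloor$ and such that the initial permutation is not unique: there are at least two distinct irreducible permutations of $\{1,\dots,n\}$ each of which starts a Rauzy path with matrices $A_1,\dots,A_N$.
   Context: A permutation $\pi$ of $\{1,\dots,n\}$ is irreducible if $\pi^{-1}(\{1,\dots,k\})\ne\{1,\dots,k\}$ for all $1\le k\le n-1$. Rauzy induction on irreducible permutations. For irreducible $\pi$ put $k=\pi^{-1}(n)$ (so $k\ne n$). Each of the two types may be applied to $\pi$: Type $0$ sends $\pi$ to $\pi'$ with $\pi'(i)=\pi(i)$ if $\pi(i)\le\pi(n)$; $\pi'(i)=\pi(i)+1$ if $\pi(n)<\pi(i)<n$; $\pi'(k)=\pi(n)+1$. The associated matrix $A$ has $A(i,i)=1$ for all $i$, $A(n,k)=1$, and all other entries $0$. Type $1$ sends $\pi$ to $\pi'$ with $\pi'(i)=\pi(i)$ if $i\le k$; $\pi'(k+1)=\pi(n)$; $\pi'(i)=\pi(i-1)$ if $k+2\le i\le n$. The associated matrix $A$ has $A(i,i)=1$ for $i\le k$, $A(i,i+1)=1$ for $k\le i\le n-1$, $A(n,k+1)=1$, and all other entries $0$. A Rauzy path is a sequence of such moves, each applied to the permutation resulting from the previous one; it starts at its initial permutation, and its matrices are the matrices associated to its successive moves. A finite Rauzy path with matrices $A_1,\dots,A_M$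 is complete if each row of the product $A_1\cdots A_M$ has at least two nonzero entries. It is $C$-complete if it is a concatenation of $C$ complete Rauzy paths. *)

(* Defs.v *)
From HB Require Import structures.
From mathcomp Require Import all_boot all_order all_fingroup all_algebra.
From mathcomp Require Import zify.

Set Implicit Arguments.
Unset Strict Implicit.
Unset Printing Implicit Defensive.

(* The index set {1, ..., n} is 'I_n with n = m.+1, shifted down by one: the
   index n is ord_max, and the initial segment {1, ..., k} is
   [set i | i < k]. *)

Definition irreducible_perm m (p : 'S_m.+1) : bool :=
  [forall k : 'I_m.+1,
    (0 < k) ==> (p @^-1: [set i : 'I_m.+1 | i < k] != [set i : 'I_m.+1 | i < k])].

Definition rauzy_k m (p : 'S_m.+1) : 'I_m.+1 := (p^-1)%g ord_max.

(* The moves are total functions on permutations; they are the intended ones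
   when rauzy_k p != ord_max, in particular when p is irreducible. *)
Definition rauzy0_fun m (p : 'S_m.+1) (i : 'I_m.+1) : 'I_m.+1 :=
  if p i <= p ord_max then p i
  else if p i < m then inord (p i).+1
  else inord (p ord_max).+1.

Definition rauzy1_fun m (p : 'S_m.+1) (i : 'I_m.+1) : 'I_m.+1 :=
  if i <= rauzy_k p then p i
  else if i == (rauzy_k p).+1 :> nat then p ord_max
  else p (inord i.-1).

Lemma rauzy0_fun_inj m (p : 'S_m.+1) : injective (rauzy0_fun p).
Proof.
move=> i j; rewrite /rauzy0_fun => /(congr1 val) /=.
have := ltn_ord (p i); have := ltn_ord (p j); have := ltn_ord (p ord_max).
move=> ? ? ?; do ![case: ifPn => ?]; rewrite ?inordK; try lia; move=> ?;
  apply/(@perm_inj _ p)/val_inj => /=; lia.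
Qed.

Lemma rauzy1_fun_inj m (p : 'S_m.+1) : injective (rauzy1_fun p).
Proof.
move=> i j; rewrite /rauzy1_fun; move: (rauzy_k p) => k.
have := ltn_ord i; have := ltn_ord j; have := ltn_ord k.
by do ![case: ifPn => ?] => ? ? ? /perm_inj /(congr1 val) /=;
  rewrite ?inordK; try lia; move=> ?; apply/val_inj => /=; lia.
Qed.

Definition rauzy_perm m (type1 : bool) (p : 'S_m.+1) : 'S_m.+1 :=
  if type1 then perm (@rauzy1_fun_inj m p) else perm (@rauzy0_fun_inj m p).

Definition rauzy_mx m (type1 : bool) (p : 'S_m.+1) : 'M[int]_m.+1 :=
  let k := rauzy_k p in
  if type1 then
    (\matrix_(i, j) [|| (i <= k)%N && (j == i),
                        (k <= i)%N && (j == i.+1 :> nat)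
                      | (i == ord_max) && (j == k.+1 :> nat)]%:R)%R
  else
    (\matrix_(i, j) ((i == j) || (i == ord_max) && (j == k))%:R)%R.

(* A path is given by its initial permutation p and the sequence ts of the
   types of its moves (true for type 1). *)
Fixpoint rauzy_path m (p : 'S_m.+1) (ts : seq bool) : bool :=
  irreducible_perm p &&
  (if ts is t :: ts' then rauzy_path (rauzy_perm t p) ts' else true).

Fixpoint rauzy_end m (p : 'S_m.+1) (ts : seq bool) : 'S_m.+1 :=
  if ts is t :: ts' then rauzy_end (rauzy_perm t p) ts' else p.

Fixpoint rauzy_mxs m (p : 'S_m.+1) (ts : seq bool) : seq 'M[int]_m.+1 :=
  if ts is t :: ts' then rauzy_mx t p :: rauzy_mxs (rauzy_perm t p) ts'
  else [::].

Definition starts_rauzy_path m (p : 'S_m.+1) (As : seq 'M[int]_m.+1) : Prop :=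
  exists ts : seq bool, rauzy_path p ts /\ rauzy_mxs p ts = As.

Definition complete_path m (p : 'S_m.+1) (ts : seq bool) : Prop :=
  rauzy_path p ts /\
  forall i : 'I_m.+1,
    2 <= #|[set j : 'I_m.+1 |
            ((\big[mulmx/1%:M]_(A <- rauzy_mxs p ts) A) i j != 0)%R]|.

Fixpoint C_complete_path m (C : nat) (p : 'S_m.+1) (ts : seq bool) : Prop :=
  if C is C'.+1 then
    exists ts1 ts2 : seq bool,
      [/\ ts = ts1 ++ ts2, complete_path p ts1
        & C_complete_path C' (rauzy_end p ts1) ts2]
  else ts = [::].

Definition C_complete_mxs m (C : nat) (As : seq 'M[int]_m.+1) : Prop :=
  exists (p : 'S_m.+1) (ts : seq bool),
    [/\ rauzy_path p ts, rauzy_mxs p ts = As & C_complete_path C p ts].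

(* Main.v *)
Require Import Defs.
From mathcomp Require Import all_boot all_order all_fingroup all_algebra.
From mathcomp Require Import zify.

Set Implicit Arguments.
Unset Strict Implicit.
Unset Printing Implicit Defensive.

Import GRing.Theory Num.Theory.

(** Label the intervals by letters.  A permutation is then a pair of words, the
    top and the bottom row: it sends the top position of a letter to its bottom
    position.  A move compares the last letters of the two rows; the loser is
    moved right behind the winner in its own row.  In the labelled bases the
    matrix is the identity plus one entry in row winner and column loser, so
    a path is complete as soon as every letter wins once.

    The entries of the matrix depend only on the type of the move and on the
    top position of the last bottom letter.  So if only a final part v of the
    bottom row is known, the next moves and their matrices are determined
    as long as v is nonempty, and the order of the hidden letters in front
    of v is irrelevant ([reads_move], [eq_rauzy_mxs]).  The known part v
    loses its last letter exactly when a hidden letter wins: the loser is then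
    inserted in the hidden part.  Two permutations whose bottom rows differ only
    by the order of two hidden letters therefore share their matrices until
    everything is hidden.  In a complete path each hidden letter wins and so
    hides another one; the number of hidden letters doubles at least, and the
    bound floor(log2 n) - 1 is reached if it exactly doubles each time, from 2 on.

    The construction keeps the configuration [stage z c D U]: the top row
    is z D U c, the known bottom suffix is c z D, and U is the set of hidden
    letters.  In one complete path, the known letters first win in a tour
    that changes nothing ([reaches_stage_turn]); then each letter of U beats and
    hides one letter of D ([reaches_absorb]), which gives a stage with a shorter
    D and with U twice as long.  The last complete path may also hide z and c
    ([reaches_last_stage]), and this makes the count come out exactly
    ([complete_runs_stage]).  The initial permutation is the rotation by 3, with
    its first two bottom letters in either order. *)

(** * Rauzy moves preserve irreducibility *)

Section Irreducible.

Variable m : nat.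
Implicit Type p : 'S_m.+1.

(** By finiteness it is enough that the prefix is mapped into itself, so that
    irreducibility can be tested with one inclusion. *)
Lemma perm_prefix_invariant p k :
  (forall i : 'I_m.+1, i < k -> p i < k) -> forall i, (p i < k) = (i < k).
Proof.
move=> stable i; pose I := [set i : 'I_m.+1 | i < k].
suff /setP/(_ i): I = p @^-1: I by rewrite !inE.
apply/eqP; rewrite eqEcard -im_permV card_imset ?leqnn ?andbT; last exact: perm_inj.
by rewrite im_permV; apply/subsetP=> j; rewrite !inE => /stable.
Qed.

Lemma irreducible_permP p :
  reflect (forall k, 0 < k <= m -> ~ forall i : 'I_m.+1, i < k -> p i < k)
          (irreducible_perm p).
Proof.
apply: (iffP forallP) => [irr k /andP[k_gt0 k_le_m] | irr k].
  move/perm_prefix_invariant=> stable; have := irr (inord k); rewrite !inordK // k_gt0 /=.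
  by case/eqP; apply/setP=> i; rewrite !inE stable.
apply/implyP=> k_gt0; apply/negP=> /eqP/setP eqI.
have [|i lt_ik] := irr k; first by rewrite k_gt0 -ltnS ltn_ord.
by have := eqI i; rewrite !inE lt_ik.
Qed.

(** A move changes the rows only behind the winner, and no invariant proper prefix
    contains the winner, which is last in one of the rows.  Hence a prefix
    invariant after the move was invariant before it. *)
Lemma irreducible_rauzy_perm ty p :
  irreducible_perm p -> irreducible_perm (rauzy_perm ty p).
Proof.
move=> /irreducible_permP irr; apply/irreducible_permP => k k_range.
move=> stable; apply: (irr k k_range) => i lt_ik; move: (stable i lt_ik).
case: ty stable => stable /=.
  have := stable (rauzy_k p); rewrite !permE /rauzy1_fun leqnn permKV /=.
  by case: ltnP => [_ /(_ isT)|le_kK _]; [|rewrite ifT]; lia.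
have := perm_prefix_invariant stable ord_max; rewrite !permE /rauzy0_fun leqnn /=.
have := ltn_ord (p i).
by do ![case: ifPn => ?] => ?; rewrite ?inordK; lia.
Qed.

Lemma irreducible_rauzy_path ts p : irreducible_perm p -> rauzy_path p ts.
Proof.
by elim: ts p => [|ty ts IH] p irr /=; rewrite irr //= IH ?irreducible_rauzy_perm.
Qed.

End Irreducible.

(** * Moves on a top word and a known bottom suffix *)

Section Words.

Variable T : eqType.
Implicit Types (t v A : seq T) (s : seq T * seq T).

(** [move type winner s1 s2], where a state [s] is the top word [s.1] together
    with a final part [s.2] of the bottom word.  In the third case the winner
    is hidden in front of this part, and so is the loser after the move. *)
Inductive move : bool -> T -> seq T * seq T -> seq T * seq T -> Prop :=
| BottomWins t1 t2 v b c :
    move true b (t1 ++ b :: rcons t2 c, rcons v b) (t1 ++ b :: c :: t2, rcons v b)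
| TopWinsSeen t v1 v2 a b :
    move false a (rcons t a, v1 ++ a :: rcons v2 b) (rcons t a, v1 ++ a :: b :: v2)
| TopWinsHidden t v a b : a \notin rcons v b ->
    move false a (rcons t a, rcons v b) (rcons t a, v).

(** The types give the Rauzy path, the winners decide on its completeness. *)
Inductive run : seq (bool * T) -> seq T * seq T -> seq T * seq T -> Prop :=
| RunNil s : run [::] s s
| RunCons ty w ms s1 s2 s3 :
    move ty w s1 s2 -> run ms s2 s3 -> run ((ty, w) :: ms) s1 s3.

(** The letters of [A] are some of those that win on the way; this is all that
    completeness needs. *)
Definition reaches A s1 s2 :=
  exists2 ms, run ms s1 s2 & {subset A <= unzip2 ms}.

(** The bottom letters outside [s.2] are still letters of the top word, hence
    every letter wins when the winners cover [s.1]. *)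
Inductive complete_runs : nat -> seq bool -> seq T * seq T -> Prop :=
| CompleteRuns0 s : complete_runs 0 [::] s
| CompleteRunsS C ms ts s1 s2 :
    run ms s1 s2 -> {subset s1.1 <= unzip2 ms} -> complete_runs C ts s2 ->
    complete_runs C.+1 (unzip1 ms ++ ts) s1.

Lemma run_cat ms1 ms2 s1 s2 s3 :
  run ms1 s1 s2 -> run ms2 s2 s3 -> run (ms1 ++ ms2) s1 s3.
Proof. by elim=> // ty w ms s4 s5 s6 mv _ IH /IH; apply: RunCons. Qed.

Lemma reaches_refl s : reaches [::] s s.
Proof. by exists [::]; first exact: RunNil. Qed.

Lemma reaches_move ty w s1 s2 : move ty w s1 s2 -> reaches [:: w] s1 s2.
Proof. by move=> mv; exists [:: (ty, w)]; first exact: RunCons mv (RunNil _). Qed.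

Lemma reaches_trans A B s1 s2 s3 :
  reaches A s1 s2 -> reaches B s2 s3 -> reaches (A ++ B) s1 s3.
Proof.
move=> [ms run_ms sA] [ms' run_ms' sB]; exists (ms ++ ms').
  exact: run_cat run_ms run_ms'.
move=> x; rewrite /unzip2 map_cat !mem_cat.
by case/orP=> [/sA-> | /sB->]; rewrite ?orbT.
Qed.

Lemma reaches_sub A B s1 s2 : {subset B <= A} -> reaches A s1 s2 -> reaches B s1 s2.
Proof. by move=> sBA [ms r sA]; exists ms => // x /sBA/sA. Qed.

(** As long as the bottom winner b wins, the letters behind it in the top word
    rotate; a full turn restores the state. *)
Lemma reaches_rotate_top t1 t2 t3 v b :
  reaches (nseq (size t3) b) (t1 ++ b :: t2 ++ t3, rcons v b)
          (t1 ++ b :: t3 ++ t2, rcons v b).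
Proof.
elim/last_ind: t3 t2 => [|t3 c IH] t2 /=; first by rewrite cats0; apply: reaches_refl.
rewrite size_rcons -cat1s -rcons_cat.
apply: reaches_trans (reaches_move (BottomWins _ _ _ _ _)) _.
by rewrite -cat_cons cat_rcons; apply: IH.
Qed.

(** The same rotation with the top winner c.  Each letter that comes last in the
    bottom word is first made to win in a full turn of the top word, so that
    the letters of v2 win as well. *)
Lemma reaches_rotate_bottom t v1 v2 c : {subset v2 <= t} ->
  reaches (nseq (size v2) c ++ v2)
    (rcons t c, c :: v1 ++ v2) (rcons t c, c :: v2 ++ v1).
Proof.
elim/last_ind: v2 v1 => [|v2 b IH] v1 sv2 /=.
  by rewrite cats0; apply: reaches_refl.
have [t1 [t2 def_t]] : exists t1 t2, t = t1 ++ b :: t2.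
  have: b \in t by rewrite sv2 // mem_rcons mem_head.
  by case/splitPr=> t1 t2; exists t1, t2.
have turn : reaches (b :: nseq (size t2) b)
    (rcons t c, c :: v1 ++ rcons v2 b) (rcons t c, c :: v1 ++ rcons v2 b).
  have := reaches_rotate_top t1 [::] (rcons t2 c) (c :: v1 ++ v2) b.
  by rewrite cats0 cat0s size_rcons def_t rcons_cat !rcons_cons rcons_cat.
have step : reaches [:: c]
    (rcons t c, c :: v1 ++ rcons v2 b) (rcons t c, c :: (b :: v1) ++ v2).
  rewrite -rcons_cat; exact: reaches_move (TopWinsSeen t [::] (v1 ++ v2) c b).
rewrite cat_rcons.
have {IH}/= := IH (b :: v1) _.
move=> /(_ _)/(reaches_trans (reaches_trans turn step)) h.
apply: reaches_sub (h _) => x; last first.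
  by move=> x_v2; rewrite sv2 // mem_rcons inE x_v2 orbT.
rewrite !(inE, mem_cat, mem_rcons, size_rcons).
by do ![case/orP]; do ?[move->]; rewrite ?orbT.
Qed.

(** Last letter against last letter, each a in A in turn beats and hides an
    e in E.  The next bottom letter y then wins once, which moves a between
    y and e and brings the next letter of A to the end.  The letters z and D
    keep their places in front, so that every letter still to be used stays
    behind the bottom winner, where that winner can move it. *)
Lemma reaches_absorb (z c : T) (D E Q A : seq T) : size A = size E -> c \in Q ->
    uniq (z :: D ++ E ++ Q ++ A) ->
  exists2 Q', perm_eq Q' (E ++ A) &
    reaches A (z :: D ++ E ++ Q ++ A, c :: z :: D ++ E)
              (z :: D ++ Q' ++ Q, c :: z :: D).
Proof.
elim/last_ind: A E Q => [|A a IH] E Q.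
  move/esym/size0nil=> -> _ _; exists [::] => //=.
  by rewrite !cats0; apply: reaches_refl.
case/lastP: E => [|E e]; rewrite !size_rcons // => -[szA] cQ uniq_t.
have [] := IH E (a :: e :: Q) szA; first by rewrite !inE cQ !orbT.
  rewrite (perm_uniq (s2 := z :: D ++ rcons E e ++ Q ++ rcons A a)) //.
  by apply/seq.permP=> P; rewrite -!cats1 /= !count_cat /= !count_cat /=; lia.
move=> Q' eqQ' r.
exists (Q' ++ [:: a; e]).
  by apply/seq.permP=> P; rewrite -!cats1 !count_cat (seq.permP eqQ') !count_cat /=; lia.
have hidden : reaches [:: a]
    (z :: D ++ rcons E e ++ Q ++ rcons A a, c :: z :: D ++ rcons E e)
    (z :: D ++ rcons E e ++ Q ++ rcons A a, c :: z :: D ++ E).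
  have := @TopWinsHidden (z :: D ++ rcons E e ++ Q ++ A) (c :: z :: D ++ E) a e.
  rewrite !rcons_cons !rcons_cat => h; apply: reaches_move (h _).
  (* The known letters all stand elsewhere in the top word, c by its place in Q. *)
  apply/negP=> a_in; move: uniq_t.
  rewrite -!rcons_cat -rcons_cons rcons_uniq => /andP[/negP[]].
  move: a_in; rewrite !(inE, mem_cat, mem_rcons).
  by case/or4P=> [/eqP-> | -> | -> | ]; rewrite ?cQ ?orbT // => /orP[] ->; rewrite ?orbT.
(* D and E may both be empty: the next bottom letter y is then z. *)
have [X [y def_zDE]] : exists X y, z :: D ++ E = rcons X y.
  by case/lastP: (z :: D ++ E) (isT : 0 < size (z :: D ++ E)) => // X y _; exists X, y.
have bottom : reaches [:: y]
    (z :: D ++ rcons E e ++ Q ++ rcons A a, c :: z :: D ++ E)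
    (z :: D ++ E ++ (a :: e :: Q) ++ A, c :: z :: D ++ E).
  have -> : z :: D ++ rcons E e ++ Q ++ rcons A a = X ++ y :: rcons (e :: Q ++ A) a.
    by rewrite -cat_rcons -def_zDE -!cats1 /= -!catA.
  have -> : z :: D ++ E ++ (a :: e :: Q) ++ A = X ++ y :: a :: e :: Q ++ A.
    by rewrite -cat_rcons -def_zDE /= -!catA.
  rewrite def_zDE; exact: reaches_move (BottomWins X (e :: Q ++ A) (c :: X) y a).
have := reaches_trans hidden (reaches_trans bottom r).
rewrite -catA; apply: reaches_sub => x.
by rewrite !inE mem_rcons inE => /orP[]->; rewrite ?orbT.
Qed.

(** z comes first on top, so that it can bring any other letter to the end; c is
    last on top and first among the known bottom letters, so that it can rotate
    all the other known letters. *)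
Definition stage z c D U : seq T * seq T := (z :: D ++ U ++ [:: c], c :: z :: D).

(** The rotation by c taken all the way round. *)
Lemma reaches_stage_turn z c D U : reaches (c :: z :: D) (stage z c D U) (stage z c D U).
Proof.
have := @reaches_rotate_bottom (z :: D ++ U) [::] (z :: D) c.
rewrite cats0 rcons_cons -cats1 -catA => turn; apply: reaches_sub (turn _) => x.
  by rewrite mem_cat inE; case/predU1P=> [->|->]; rewrite ?mem_nseq ?eqxx ?orbT.
by rewrite !inE mem_cat; case/orP=> ->; rewrite ?orbT.
Qed.

(** One win against c brings the letters of U to the end of the top word. *)
Lemma reaches_stage_unlock z c D U :
  reaches [::] (stage z c D U) (z :: D ++ c :: U, c :: z :: D).
Proof.
have [X [y def_zD]] : exists X y, z :: D = rcons X y.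
  by case/lastP: (z :: D) (isT : 0 < size (z :: D)) => // X y _; exists X, y.
rewrite /stage -!cat_cons def_zD !cat_rcons cats1.
by apply: (@reaches_sub [:: y]) => //; apply: reaches_move (BottomWins X U (c :: X) y c).
Qed.

(** The tour makes the known letters win, and the absorption the letters of U;
    these are all the letters of the top word. *)
Lemma reaches_stage z c D E U : size U = size E ->
    uniq (z :: (D ++ E) ++ U ++ [:: c]) ->
  exists2 U', perm_eq U' (E ++ U) &
    reaches (z :: (D ++ E) ++ U ++ [:: c]) (stage z c (D ++ E) U) (stage z c D U').
Proof.
move=> szU uniq_t.
have [||U' eqU' r] := @reaches_absorb z c D E [:: c] U szU; first exact: mem_head.
  rewrite (perm_uniq (s2 := z :: (D ++ E) ++ U ++ [:: c])) //.
  by apply/seq.permP=> P; rewrite /= !count_cat /=; lia.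
exists U' => //.
have u := reaches_stage_unlock z c (D ++ E) U; rewrite -catA in u.
apply: reaches_sub (reaches_trans (reaches_stage_turn z c (D ++ E) U)
                                  (reaches_trans u r)) => x.
by rewrite !(inE, mem_cat); do ?[case/orP]; do ?move=> ->; rewrite ?orbT.
Qed.

(** No stage has to be restored afterwards, hence z and c may be hidden too.
    Once D is exhausted at most two letters of U are left.  The last one beats
    z; if there is another one, then c beats the last one and the other one
    beats c. *)
Lemma reaches_last_stage z c D U : size D < size U <= (size D).+2 ->
    uniq (z :: D ++ U ++ [:: c]) ->
  exists s, reaches (z :: D ++ U ++ [:: c]) (stage z c D U) s.
Proof.
move=> /andP[lt_DU le_UD] uniq_t.
pose j := size U - size D; pose U1 := take j U; pose A := drop j U.
have defU : U = U1 ++ A by rewrite cat_take_drop.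
have szA : size A = size D by rewrite size_drop /j; lia.
have szU1 : 0 < size U1 <= 2 by rewrite size_takel /j; lia.
have [||Q eqQ r] := @reaches_absorb z c [::] D (c :: U1) A szA; first exact: mem_head.
  rewrite (perm_uniq (s2 := z :: D ++ U ++ [:: c])) //.
  by apply/seq.permP=> P; rewrite defU /= !count_cat /= !count_cat /=; lia.
have {r} start := reaches_trans (reaches_stage_turn z c D _)
  (reaches_trans (reaches_stage_unlock z c D (U1 ++ A)) r).
have U1P x : x \in U1 -> x \notin [:: c; z].
  move=> xU1; apply/negP=> x_cz.
  have: 2 <= count_mem x (z :: D ++ U ++ [:: c]).
    have := xU1; rewrite -has_pred1 has_count defU /= !count_cat /=.
    by move: x_cz; rewrite !inE ![x == _]eq_sym => /orP[]->; lia.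
  by rewrite count_uniq_mem //; case: (x \in _).
suff [s last] : exists s, reaches U1 (z :: Q ++ c :: U1, [:: c; z]) s.
  exists s; rewrite defU; apply: reaches_sub (reaches_trans start last) => x.
  by rewrite !(inE, mem_cat); do ?[case/orP]; do ?move=> ->; rewrite ?orbT.
move: U1 {defU start} szU1 U1P => U1.
case/lastP: U1 => // U1 a; rewrite size_rcons ltnS => szU1 U1P.
have hidden : reaches [:: a] (z :: Q ++ c :: rcons U1 a, [:: c; z])
                             (z :: Q ++ c :: rcons U1 a, [:: c]).
  have := @TopWinsHidden (z :: Q ++ c :: U1) [:: c] a z.
  rewrite !rcons_cons rcons_cat rcons_cons => h; apply: reaches_move (h _).
  by rewrite U1P // mem_rcons mem_head.
case: U1 szU1 U1P hidden => [|a' [|//]] _ U1P hidden; first by eexists; apply: hidden.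
have bottom := reaches_move (BottomWins (z :: Q) [:: a'] [::] c a).
have h := @TopWinsHidden (z :: Q ++ [:: c; a]) [::] a' c.
have {h} := reaches_move (h _); rewrite !rcons_cons !rcons_cat /=.
move=> /(_ _)/(reaches_trans (reaches_trans hidden bottom)) h.
exists (z :: Q ++ [:: c; a; a'], [::]); apply: reaches_sub (h _).
  by move=> x; rewrite !inE => /orP[]->; rewrite ?orbT.
have := U1P a'; rewrite !inE eqxx => /(_ isT); by rewrite negb_or => /andP[].
Qed.

(** The number of letters [size D + size U + 2] is constant along the stages,
    while [size U] doubles; thus the last stage is reached with
    [size U * 2] at most equal to that number. *)
Lemma complete_runs_stage C z c D U :
    uniq (z :: D ++ U ++ [:: c]) -> 0 < size U ->
    size U * 2 ^ C <= (size D + size U).+2 ->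
  exists ts, complete_runs C ts (stage z c D U).
Proof.
elim: C D U => [|C IH] D U uniq_t U_gt0 leC; first by exists [::]; left.
have [le_UD | lt_DU] := leqP (size U) (size D).
  have [D1 [E [defD szE]]] : exists D1 E, D = D1 ++ E /\ size U = size E.
    exists (take (size D - size U) D), (drop (size D - size U) D).
    by rewrite cat_take_drop size_drop; split=> //; lia.
  rewrite defD in uniq_t leC *.
  have [U' eqU' [ms r sub]] := reaches_stage szE uniq_t.
  have szU' : size U' = size E + size U by rewrite (perm_size eqU') size_cat.
  have [|||ts cts] := IH D1 U'.
  - rewrite (perm_uniq (s2 := z :: (D1 ++ E) ++ U ++ [:: c])) //.
    by apply/seq.permP=> P; rewrite /= !count_cat (seq.permP eqU') !count_cat; lia.
  - by rewrite szU' addn_gt0 U_gt0 orbT.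
  - by move: leC; rewrite szU' -szE size_cat expnS mulnA; lia.
  by exists (unzip1 ms ++ ts); apply: CompleteRunsS r sub cts.
(* If U is too long for a full stage, the bound leaves only the last one. *)
have C0 : C = 0.
  case: C leC {IH} => // C; rewrite !expnS; have := expn_gt0 2 C; nia.
rewrite C0 in leC *.
have [||s [ms r sub]] := @reaches_last_stage z c D U; [lia | by [] |].
by exists (unzip1 ms ++ [::]); apply: CompleteRunsS r sub _; left.
Qed.

End Words.

(** * Permutations that realize a state *)

Section Reading.

Variables (T : eqType) (x0 : T) (m : nat).
Implicit Types (t v : seq T) (s : seq T * seq T) (p q : 'S_m.+1).

(** The bottom row of p, written with the letters of [s.1], ends with [s.2]:
    bottom position [p i] carries the letter in top position [i]. *)
Definition reads p s :=
  [/\ uniq s.1, size s.1 = m.+1, size s.2 <= m.+1 &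
      forall i : 'I_m.+1, m.+1 - size s.2 <= p i ->
        nth x0 s.1 i = nth x0 s.2 (p i - (m.+1 - size s.2))].

Lemma nth_top_inj p s : reads p s ->
  injective (fun i : 'I_m.+1 => nth x0 s.1 i).
Proof.
case=> uniq_t szt _ _ i j /eqP; rewrite nth_uniq ?szt ?ltn_ord // => /eqP.
exact: val_inj.
Qed.

Lemma reads_rauzy_k p t v b : reads p (t, rcons v b) -> nth x0 t (rauzy_k p) = b.
Proof.
case=> _ _ /= szv rd; have := rd (rauzy_k p); rewrite permKV /=.
rewrite size_rcons in szv *; rewrite subSS leq_subr subKn // => -> //.
by rewrite nth_rcons ltnn eqxx.
Qed.

Lemma reads_nth p t v j : reads p (t, v) -> j < size v ->
  exists2 i : 'I_m.+1, nth x0 t i = nth x0 v j & p i = m.+1 - size v + j :> nat.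
Proof.
case=> _ _ /= szv rd lt_jv; have lt_pos : m.+1 - size v + j < m.+1 by lia.
by exists ((p^-1)%g (Ordinal lt_pos)); rewrite ?rd permKV /= ?leq_addr ?addKn.
Qed.

Lemma rauzy_k_bottom_wins p t1 t2 v b :
  reads p (t1 ++ b :: t2, rcons v b) -> rauzy_k p = size t1 :> nat.
Proof.
move=> rd; have [uniq_t szt _ _] := rd; apply/eqP.
have lt_b : size t1 < m.+1 by rewrite -szt size_cat /=; lia.
by rewrite -(nth_uniq x0 _ _ uniq_t) ?szt //= (reads_rauzy_k rd) nth_cat ltnn subnn.
Qed.

(** The moves on words are the moves on permutations.  In the third case,
    that the winner is hidden means that it stands in front of all the known
    letters, so that these shift by one position. *)
Lemma reads_move ty w p s1 s2 :
  move ty w s1 s2 -> reads p s1 -> reads (rauzy_perm ty p) s2.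
Proof.
case=> [t1 t2 v b c | t v1 v2 a b | t v a b a_notin] rd.
- have kE := rauzy_k_bottom_wins rd; case: rd => /= uniq_t szt szv rd.
  have szt' : (size t1 + size t2).+2 = m.+1 by rewrite -szt size_cat /= size_rcons; lia.
  split=> //=.
  + rewrite (perm_uniq (s2 := t1 ++ b :: rcons t2 c)) // perm_cat2l perm_cons.
    by rewrite perm_sym perm_rcons.
  + by rewrite size_cat /=; lia.
  move=> i; rewrite permE /rauzy1_fun kE.
  case: (leqP i (size t1)) => [le_ik | lt_ki].
    move=> /rd; rewrite !nth_cat; case: ltnP => // le_ki.
    by have -> : i - size t1 = 0 by lia.
  case: eqP => [i_eq | i_neq] /rd <- /=.
    rewrite !nth_cat i_eq ltnNge leqnSn /= subSnn /=.
    rewrite ifN; last lia.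
    have -> : m - size t1 = (size t2).+1 by lia.
    by rewrite /= nth_rcons ltnn eqxx.
  have lt_im := ltn_ord i; rewrite inordK; last lia.
  rewrite !nth_cat !ifN; [|lia..].
  have [d i_def] : exists d, i = d.+2 + size t1 :> nat by exists (i - (size t1).+2); lia.
  have -> : i.-1 - size t1 = d.+1 by lia.
  have -> : i - size t1 = d.+2 by lia.
  by rewrite /= nth_rcons ifT //; lia.
- have lt_a : size v1 < size (v1 ++ a :: rcons v2 b) by rewrite size_cat /=; lia.
  have [i0 i0a pi0] := reads_nth rd lt_a.
  have def_i0 : i0 = ord_max.
    apply: (nth_top_inj rd); have [_ /= szt _ _] := rd.
    move: szt; rewrite i0a size_rcons nth_cat ltnn subnn => -[<-] /=.
    by rewrite nth_rcons ltnn eqxx.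
  rewrite def_i0 in pi0; case: rd => /= uniq_t szt szv rd.
  have sz_v : size (v1 ++ a :: rcons v2 b) = (size v1 + size v2).+2.
    by rewrite size_cat /= size_rcons; lia.
  have sz_v' : size (v1 ++ a :: b :: v2) = (size v1 + size v2).+2.
    by rewrite size_cat /=; lia.
  rewrite sz_v in pi0 szv rd; split; rewrite /= ?sz_v' // => i.
  rewrite permE /rauzy0_fun; have lt_pi := ltn_ord (p i).
  case: (leqP (p i) (p ord_max)) => [le_pi | gt_pi].
    move=> /rd ->; rewrite !nth_cat; case: ltnP => // ge_pi.
    by have -> : p i - (m.+1 - (size v1 + size v2).+2) - size v1 = 0 by lia.
  case: (ltnP (p i) m) => [lt_pim | ge_pim].
    rewrite rd; last lia.
    have [d d_def] :
        exists d, p i = m.+1 - (size v1 + size v2).+2 + size v1 + d.+1 :> nat.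
      by exists (p i - (p ord_max).+1); lia.
    rewrite inordK; last lia.
    have -> : p i - (m.+1 - (size v1 + size v2).+2) = size v1 + d.+1 by lia.
    have -> : (p i).+1 - (m.+1 - (size v1 + size v2).+2) = size v1 + d.+2 by lia.
    by rewrite !nth_cat !ltnNge !leq_addr !addKn /= nth_rcons ifT //; lia.
  rewrite rd; last lia.
  rewrite inordK; last lia.
  have -> : p i - (m.+1 - (size v1 + size v2).+2) = size v1 + (size v2).+1 by lia.
  have -> : (p ord_max).+1 - (m.+1 - (size v1 + size v2).+2) = size v1 + 1 by lia.
  by rewrite !nth_cat !ltnNge !leq_addr !addKn /= nth_rcons ltnn eqxx.
have a_hidden : p ord_max < m.+1 - size (rcons v b).
  rewrite ltnNge; apply/negP=> ge_p; case: rd => /= uniq_t szt szv /(_ _ ge_p).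
  have -> : nth x0 (rcons t a) (@ord_max m) = a.
    by move: szt; rewrite size_rcons => -[<-] /=; rewrite nth_rcons ltnn eqxx.
  move=> a_eq; case/negP: a_notin; rewrite a_eq mem_nth //.
  by have := ltn_ord (p ord_max); lia.
case: rd => /= uniq_t szt szv rd; rewrite size_rcons in szv rd a_hidden.
split=> //=; first exact: ltnW.
move=> i; rewrite permE /rauzy0_fun; have lt_pi := ltn_ord (p i).
case: (leqP (p i) (p ord_max)) => [|gt_pi]; first by lia.
case: (ltnP (p i) m) => [lt_pim | ge_pim]; rewrite inordK; try lia.
move=> le_p; rewrite rd; last lia.
have -> : (p i).+1 - (m.+1 - size v) = p i - (m.+1 - (size v).+1) by lia.
by rewrite nth_rcons ifT //; lia.
Qed.


Lemma move_bottom ty w s1 s2 : move ty w s1 s2 -> exists v b, s1.2 = rcons v b.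
Proof.
case=> [t1 t2 v b c | t v1 v2 a b | t v a b _] /=; try by exists v, b.
by exists (v1 ++ a :: v2), b; rewrite rcons_cat.
Qed.

Lemma eq_rauzy_mx ty w p q s1 s2 : move ty w s1 s2 -> reads p s1 -> reads q s1 ->
  rauzy_mx ty p = rauzy_mx ty q.
Proof.
move=> /move_bottom; case: s1 => t _ [v [b /= ->]] rdp rdq.
rewrite /rauzy_mx; suff -> : rauzy_k p = rauzy_k q by [].
by apply: (nth_top_inj rdp); rewrite (reads_rauzy_k rdp) (reads_rauzy_k rdq).
Qed.

Lemma rauzy_mx_ge0 ty p i j : (0 <= rauzy_mx ty p i j)%R.
Proof. by case: ty; rewrite mxE ler0n. Qed.

(** The diagonal entries in the labelled bases: rows are indexed by the top word
    before the move, columns by the top word after it. *)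
Lemma rauzy_mx_same_letter ty w p s1 s2 (i j : 'I_m.+1) : move ty w s1 s2 -> reads p s1 ->
  nth x0 s1.1 i = nth x0 s2.1 j -> (0 < rauzy_mx ty p i j)%R.
Proof.
move=> mv rd; have rd' := reads_move mv rd; move: rd rd'.
case: mv => [t1 t2 v b c | t v1 v2 a b | t v a b _] rd rd' /= eq_ij;
  [|by rewrite mxE (nth_top_inj rd eq_ij) eqxx..].
rewrite mxE (rauzy_k_bottom_wins rd) ltr0n lt0b.
have [uniq_t /= szt _ _] := rd'.
(* j' is the new position of the letter that was in position i. *)
pose j' := if i <= size t1 then i : nat else if i == ord_max then (size t1).+1 else i.+1.
have szt' : (size t1 + size t2).+2 = m.+1 by rewrite -szt size_cat /=; lia.
have lt_im := ltn_ord i.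
have lt_j' : j' < m.+1.
  rewrite /j'; case: (leqP i (size t1)) => _; first exact: lt_im.
  case: eqP => [_|i_neq]; first lia.
  by have : i <> m :> nat; [move=> i_m; apply: i_neq; apply: val_inj | lia].
have j_def : j = j' :> nat.
  apply/eqP; rewrite -(nth_uniq x0 _ _ uniq_t) ?szt // -eq_ij /j'.
  rewrite !nth_cat; case: (leqP i (size t1)) => [le_i|gt_i].
    by case: ltnP => // ge_i; have -> : i - size t1 = 0 by lia.
  rewrite ifN; last lia.
  case: (i =P ord_max) => [->|i_neq].
    rewrite /= ltnNge leqnSn subSnn.
    have -> : m - size t1 = (size t2).+1 by lia.
    by rewrite /= nth_rcons ltnn eqxx.
  have i_neqm : i <> m :> nat by move=> i_m; apply: i_neq; apply: val_inj.
  rewrite ifN; last lia.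
  have [d i_def] : exists d, i = d.+1 + size t1 :> nat by exists (i - (size t1).+1); lia.
  by rewrite i_def -addSn !addnK /= nth_rcons ifT //; lia.
rewrite -val_eqE /= j_def /j'; case: (leqP i (size t1)) => [|/ltnW->]; first by lia.
by case: (i =P ord_max) => _; rewrite eqxx ?orbT.
Qed.

Lemma rauzy_mx_loser ty w p s1 s2 : move ty w s1 s2 -> reads p s1 ->
  exists y, [/\ y != w, y \in s2.1 & forall i j : 'I_m.+1,
    nth x0 s1.1 i = w -> nth x0 s2.1 j = y -> (0 < rauzy_mx ty p i j)%R].
Proof.
have top_wins t a v b : reads p (rcons t a, rcons v b) -> b != a ->
    exists y, [/\ y != a, y \in rcons t a & forall i j : 'I_m.+1,
      nth x0 (rcons t a) i = a -> nth x0 (rcons t a) j = y ->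
      (0 < rauzy_mx false p i j)%R].
  move=> rd neq_ba; have [uniq_t /= szt _ _] := rd.
  exists b; split=> // [|i j].
    by rewrite -(reads_rauzy_k rd) mem_nth // szt.
  move=> nth_i nth_j; rewrite mxE.
  have -> : i = ord_max.
    apply: (nth_top_inj rd); rewrite nth_i.
    by move: szt; rewrite size_rcons => -[<-] /=; rewrite nth_rcons ltnn eqxx.
  have -> : j = rauzy_k p by apply: (nth_top_inj rd); rewrite nth_j (reads_rauzy_k rd).
  by rewrite !eqxx orbT.
move=> mv rd; have rd' := reads_move mv rd; move: rd rd'.
case: mv => [t1 t2 v b c | t v1 v2 a b | t v a b a_notin] rd rd' /=.
- have [uniq_t /= szt _ _] := rd; have [uniq_t' /= szt' _ _] := rd'.
  exists c; split.
  + by move: uniq_t'; rewrite cat_uniq /= !inE eq_sym; case/and3P=> _ _ /andP[/norP[]].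
  + by rewrite mem_cat !inE eqxx !orbT.
  move=> i j /eqP nth_i /eqP nth_j; rewrite mxE (rauzy_k_bottom_wins rd) ltr0n lt0b.
  have lt_c : (size t1).+1 < m.+1 by rewrite -szt' size_cat /=; lia.
  have i_def : i = size t1 :> nat.
    apply/eqP; rewrite -(nth_uniq x0 _ _ uniq_t) ?szt //; last lia.
    by rewrite (eqP nth_i) nth_cat ltnn subnn.
  have j_def : j = (size t1).+1 :> nat.
    apply/eqP; rewrite -(nth_uniq x0 _ _ uniq_t') ?szt' //.
    by rewrite (eqP nth_j) nth_cat ltnNge leqnSn subSnn.
  by rewrite i_def j_def leqnn eqxx orbT.
- rewrite -cat_rcons -rcons_cat in rd; apply: (top_wins _ _ _ _ rd).
  (* A letter read at two bottom positions would have two top positions. *)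
  apply/negP=> /eqP eq_ba; have [_ _ /= szv _] := rd.
  have lt_a : size v1 < size (rcons (rcons v1 a ++ v2) b).
    by rewrite size_rcons size_cat size_rcons; lia.
  have [i nth_i pi] := reads_nth rd lt_a.
  have i_k : i = rauzy_k p.
    apply: (nth_top_inj rd); rewrite (reads_rauzy_k rd) nth_i eq_ba.
    by rewrite rcons_cat cat_rcons nth_cat ltnn subnn.
  move: pi szv; rewrite i_k permKV /= size_rcons size_cat size_rcons; lia.
by apply: top_wins rd _; apply: contraNneq a_notin => <-; rewrite mem_rcons mem_head.
Qed.

(** * Matrices along a path *)

Lemma eq_rauzy_mxs ms p q s1 s2 : run ms s1 s2 -> reads p s1 -> reads q s1 ->
  rauzy_mxs p (unzip1 ms) = rauzy_mxs q (unzip1 ms).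
Proof.
move=> r; elim: r p q => //= ty w ms' s3 s4 s5 mv _ IH p q rdp rdq.
by rewrite (eq_rauzy_mx mv rdp rdq) (IH _ _ (reads_move mv rdp) (reads_move mv rdq)).
Qed.

Lemma reads_run ms p s1 s2 : run ms s1 s2 -> reads p s1 ->
  reads (rauzy_end p (unzip1 ms)) s2.
Proof.
by move=> r; elim: r p => //= ty w ms' s3 s4 s5 mv _ IH p /(reads_move mv)/IH.
Qed.

Lemma rauzy_mxs_cat p ts1 ts2 :
  rauzy_mxs p (ts1 ++ ts2) = rauzy_mxs p ts1 ++ rauzy_mxs (rauzy_end p ts1) ts2.
Proof. by elim: ts1 p => //= ty ts IH p; rewrite IH. Qed.

Definition path_mx p ts : 'M[int]_m.+1 :=
  (\big[mulmx/1%:M]_(A <- rauzy_mxs p ts) A)%R.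

Lemma path_mx_cons p ty ts :
  path_mx p (ty :: ts) = (rauzy_mx ty p *m path_mx (rauzy_perm ty p) ts)%R.
Proof. by rewrite /path_mx /= big_cons. Qed.

Lemma path_mx_ge0 p ts i j : (0 <= path_mx p ts i j)%R.
Proof.
elim: ts p i j => [|ty ts IH] p i j.
  by rewrite /path_mx big_nil mxE ler0n.
rewrite path_mx_cons mxE sumr_ge0 // => h _.
by rewrite mulr_ge0 ?rauzy_mx_ge0.
Qed.

Lemma path_mx_cons_gt0 p ty ts i h j : (0 < rauzy_mx ty p i h)%R ->
  (0 < path_mx (rauzy_perm ty p) ts h j)%R -> (0 < path_mx p (ty :: ts) i j)%R.
Proof.
move=> gt_ih gt_hj; rewrite path_mx_cons mxE (bigD1 h) //=.
rewrite ltr_pwDl ?mulr_gt0 // sumr_ge0 // => l _.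
by rewrite mulr_ge0 ?rauzy_mx_ge0 ?path_mx_ge0.
Qed.

Lemma letter_position p s x : reads p s -> x \in s.1 ->
  exists i : 'I_m.+1, nth x0 s.1 i = x.
Proof.
case=> _ szt _ _ xt; have lt_x : index x s.1 < m.+1 by rewrite -szt index_mem.
by exists (Ordinal lt_x); rewrite nth_index.
Qed.

Lemma move_top ty w s1 s2 : move ty w s1 s2 -> s1.1 =i s2.1.
Proof.
case=> // t1 t2 v b c x /=.
by rewrite !(mem_cat, inE, mem_rcons).
Qed.

Lemma nth_top_in p s (i : 'I_m.+1) : reads p s -> nth x0 s.1 i \in s.1.
Proof. by case=> _ szt _ _; rewrite mem_nth // szt. Qed.

Lemma path_mx_same_letter ms p s1 s2 (i j : 'I_m.+1) : run ms s1 s2 -> reads p s1 ->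
  nth x0 s1.1 i = nth x0 s2.1 j -> (0 < path_mx p (unzip1 ms) i j)%R.
Proof.
move=> r; elim: r p i => [s|ty w ms' s3 s4 s5 mv r IH] p i rd eq_ij.
  by rewrite (nth_top_inj rd eq_ij) /path_mx big_nil mxE eqxx.
have rd' := reads_move mv rd.
have [h eq_h] : exists h : 'I_m.+1, nth x0 s4.1 h = nth x0 s3.1 i.
  by apply: letter_position rd' _; rewrite -(move_top mv) (nth_top_in i rd).
apply: path_mx_cons_gt0 (rauzy_mx_same_letter mv rd (esym eq_h)) (IH _ _ rd' _).
by rewrite eq_h.
Qed.

Lemma run_top ms s1 s2 : run ms s1 s2 -> s1.1 =i s2.1.
Proof. by elim=> // ty w ms' s3 s4 s5 /move_top eq34 _ eq45 x; rewrite eq34. Qed.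

(** Once w has beaten a letter y, the entry of row w and column y remains
    positive, because all matrices are nonnegative with positive
    diagonal entries in the labelled bases. *)
Lemma path_mx_winner ms p s1 s2 w : run ms s1 s2 -> reads p s1 ->
    w \in unzip2 ms ->
  exists y, [/\ y != w, y \in s2.1 & forall i j : 'I_m.+1,
    nth x0 s1.1 i = w -> nth x0 s2.1 j = y -> (0 < path_mx p (unzip1 ms) i j)%R].
Proof.
move=> r; elim: r p => //= ty w' ms' s3 s4 s5 mv r IH p rd.
have rd' := reads_move mv rd.
rewrite inE; have [-> _|_ /= w_later] := eqVneq w w'.
  have [y [neq_y y_in gt0]] := rauzy_mx_loser mv rd.
  exists y; split=> // [|i j i_w j_y]; first by rewrite -(run_top r).
  have [h h_y] := letter_position rd' y_in.
  apply: path_mx_cons_gt0 (gt0 i h i_w h_y) (path_mx_same_letter r rd' _).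
  by rewrite h_y j_y.
have [y [neq_y y_in gt0]] := IH _ rd' w_later.
exists y; split=> // i j i_w j_y.
have [h h_w] : exists h : 'I_m.+1, nth x0 s4.1 h = w.
  by apply: letter_position rd' _; rewrite -(move_top mv) -i_w (nth_top_in i rd).
apply: path_mx_cons_gt0 (rauzy_mx_same_letter mv rd _) (gt0 h j h_w j_y).
by rewrite i_w h_w.
Qed.

Lemma complete_path_run ms p s1 s2 : run ms s1 s2 -> reads p s1 ->
    irreducible_perm p -> {subset s1.1 <= unzip2 ms} ->
  complete_path p (unzip1 ms).
Proof.
move=> r rd irr all_win; split=> [|i]; first exact: irreducible_rauzy_path.
have rd' := reads_run r rd; have i_in := nth_top_in i rd.
have [y [neq_y y_in gt0]] := path_mx_winner r rd (all_win _ i_in).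
have [j1 j1_def] : exists j : 'I_m.+1, nth x0 s2.1 j = nth x0 s1.1 i.
  by apply: letter_position rd' _; rewrite -(run_top r).
have [j2 j2_def] := letter_position rd' y_in.
have neq_j : j1 != j2.
  by apply: contraNneq neq_y => eq_j; rewrite -j2_def -j1_def eq_j.
apply: (@leq_trans #|[set j1; j2]|); first by rewrite cards2 neq_j.
apply: subset_leq_card; apply/subsetP=> j; rewrite !inE => /orP[]/eqP->; apply: lt0r_neq0.
  exact: path_mx_same_letter r rd (esym j1_def).
exact: gt0.
Qed.

Lemma irreducible_rauzy_end ts p :
  irreducible_perm p -> irreducible_perm (rauzy_end p ts).
Proof. by elim: ts p => //= ty ts IH p /(irreducible_rauzy_perm ty)/IH. Qed.

Lemma complete_runs_C_complete C ts s p : complete_runs C ts s -> reads p s ->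
  irreducible_perm p -> C_complete_path C p ts.
Proof.
move=> cr; elim: cr p => //= C' ms ts' s1 s2 r all_win _ IH p rd irr.
exists (unzip1 ms), ts'; split=> //; first exact: complete_path_run r rd irr all_win.
by apply: IH; [exact: reads_run r rd | exact: irreducible_rauzy_end].
Qed.

Lemma complete_runs_mxs C ts s p q : complete_runs C ts s -> reads p s ->
  reads q s -> rauzy_mxs p ts = rauzy_mxs q ts.
Proof.
move=> cr; elim: cr p q => //= C' ms ts' s1 s2 r _ _ IH p q rdp rdq.
rewrite !rauzy_mxs_cat (eq_rauzy_mxs r rdp rdq).
by rewrite (IH _ _ (reads_run r rdp) (reads_run r rdq)).
Qed.

End Reading.

(** * Two initial permutations *)

Section Start.

Variable m : nat.
Hypothesis m_ge3 : 3 <= m.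

(** With the top word 0 1 ... m this permutation has the bottom word
    m-2, m-1, m, 0, 1, ..., m-3: it is a stage with z = 0, c = m and
    the hidden letters m-2, m-1. *)
Definition shift3 (i : 'I_m.+1) : 'I_m.+1 := inord ((i + 3) %% m.+1).

Lemma shift3_inj : injective shift3.
Proof.
move=> i j /(congr1 val); rewrite /= !inordK ?ltn_mod // => /eqP.
by rewrite eqn_modDr !modn_small // => /eqP/val_inj.
Qed.

Definition start_perm : 'S_m.+1 := perm shift3_inj.

(** The first two bottom positions, those of the hidden letters, are exchanged. *)
Definition swapped_start_perm : 'S_m.+1 := (start_perm * tperm ord0 (inord 1))%g.

Lemma start_permE (i : 'I_m.+1) :
  start_perm i = (if i + 3 <= m then i + 3 else i + 3 - m.+1) :> nat.
Proof.
have lt_im := ltn_ord i; rewrite permE /= inordK ?ltn_mod //.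
case: leqP => [le_im|gt_im]; first by rewrite modn_small.
have {1}-> : i + 3 = m.+1 + (i + 3 - m.+1) by lia.
by rewrite modnDl modn_small //; lia.
Qed.

Lemma swapped_start_perm_eq (i : 'I_m.+1) :
  (2 <= start_perm i) || (2 <= swapped_start_perm i) ->
  swapped_start_perm i = start_perm i.
Proof.
rewrite permM; have val1 : (inord 1 : 'I_m.+1) = 1 :> nat by rewrite inordK //; lia.
by case: tpermP => [->|->|//]; rewrite /= val1.
Qed.

(** An invariant prefix of length k would contain the top position k - 1, which
    moves 3 steps further, or the position m - 3, which moves to m. *)
Lemma irreducible_start (p : 'S_m.+1) :
  (forall i : 'I_m.+1, i + 3 <= m -> p i = i + 3 :> nat) -> irreducible_perm p.
Proof.
move=> pE; apply/irreducible_permP=> k /andP[k_gt0 le_km] stable.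
have [le_k|gt_k] := leqP k (m - 2).
  have := stable (inord k.-1); have := pE (inord k.-1); rewrite inordK; last lia.
  lia.
by have := stable (inord (m - 3)); have := pE (inord (m - 3)); rewrite inordK; lia.
Qed.

Definition start_stage := stage 0 m (iota 1 (m - 3)) [:: m.-2; m.-1].

Lemma start_stage_top : start_stage.1 = iota 0 m.+1.
Proof.
have -> : m.+1 = (1 + (m - 3) + 3) by lia.
rewrite iotaD iotaD /=; congr (_ :: _ ++ _).
by rewrite !add1n; congr [:: _; _; _]; lia.
Qed.

Lemma reads_start (p : 'S_m.+1) : (forall i, 2 <= p i -> p i = start_perm i) ->
  reads 0 p start_stage.
Proof.
move=> pE; split.
- by rewrite start_stage_top iota_uniq.
- by rewrite start_stage_top size_iota.
- by rewrite /= size_iota; lia.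
move=> i; rewrite start_stage_top nth_iota ?ltn_ord // add0n [size _]/= size_iota.
have -> : m.+1 - (m - 3).+2 = 2 by lia.
move=> ge2; move: (ge2); rewrite (pE _ ge2).
rewrite start_permE; have lt_im := ltn_ord i; case: ifPn => [le_im _|gt_im ge2'].
  have -> : i + 3 - 2 = i.+1 by lia.
  case: (val i) le_im => [|j] /= le_jm; first by [].
  by rewrite nth_iota; lia.
have -> : i + 3 - m.+1 - 2 = 0 by lia.
rewrite /=; lia.
Qed.

End Start.

Theorem theorem2 (m : nat) (hn : 4 <= m.+1) :
  exists (N : nat) (As : N.-tuple 'M[int]_m.+1),
    C_complete_mxs (trunc_log 2 m.+1 - 1) As /\
    exists p q : 'S_m.+1,
      [/\ p != q, irreducible_perm p, irreducible_perm q,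
          starts_rauzy_path p As & starts_rauzy_path q As].
Proof.
have m_ge3 : 3 <= m := hn.
pose p := start_perm m; pose q := swapped_start_perm m; set C := (_ - 1).
have irr_p : irreducible_perm p.
  by apply: (irreducible_start m_ge3) => i le_im; rewrite (start_permE m_ge3) le_im.
have irr_q : irreducible_perm q.
  apply: (irreducible_start m_ge3) => i le_im.
  by rewrite (swapped_start_perm_eq m_ge3) (start_permE m_ge3) le_im //; lia.
have rd_p : reads 0 p (start_stage m) by apply: reads_start.
have rd_q : reads 0 q (start_stage m).
  by apply: reads_start => // i ge2; rewrite (swapped_start_perm_eq m_ge3) // ge2 orbT.
have [ts cr] : exists ts, complete_runs C ts (start_stage m).
  apply: complete_runs_stage => //.
    by have [] := rd_p.
  (* There are 2 hidden letters at first: the bound reads 2 * 2 ^ C <= m.+1. *)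
  have : 2 ^ trunc_log 2 m.+1 <= m.+1 by exact: trunc_logP.
  have : 0 < trunc_log 2 m.+1 by rewrite trunc_log_gt0 //; lia.
  rewrite /C; case: trunc_log => // l _; rewrite subn1 /= expnS size_iota; lia.
exists (size (rauzy_mxs p ts)), (in_tuple (rauzy_mxs p ts)); split.
  exists p, ts; split=> //; first exact: irreducible_rauzy_path.
  exact: complete_runs_C_complete cr rd_p irr_p.
exists p, q; split=> //.
- apply/eqP=> eq_pq.
  have: (tperm ord0 (inord 1) : 'S_m.+1) = 1%g by apply: (mulgI p); rewrite mulg1.
  by move=> /permP/(_ ord0)/(congr1 val); rewrite tpermL perm1 /= inordK; lia.
- by exists ts; split; first exact: irreducible_rauzy_path.
exists ts; split; first exact: irreducible_rauzy_path.
by rewrite (complete_runs_mxs cr rd_p rd_q).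
Qed.
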